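(* Assume that $(\varepsilon_t)_{t\in\mathbb{Z}}$ and $(\eta_t)_{t\in\mathbb{Z}}$ are mutually independent strong white noises such that $\mathbb{E}[\ln^+|\varepsilon_0|]<\infty$ and $\mathbb{E}[\ln|\theta+\alpha\,\eta_0+\eta_1|]<0$. Then the recurrence $X_t=\theta_t X_{t-1}+\varepsilon_t$, with $\theta_t=\theta+\alpha\,\eta_{t-1}+\eta_t$ $(t\in\mathbb{Z})$, admits the causal solution given almost surely, for all $t\in\mathbb{Z}$, by the (almost surely convergent) series $$X_t=\varepsilon_t+\sum_{k=1}^{\infty}\varepsilon_{t-k}\prod_{\ell=0}^{k-1}(\theta+\alpha\,\eta_{t-\ell-1}+\eta_{t-\ell}).$$ In addition, $(X_t)$ is strictly stationary and ergodic.
   Context: $\theta,\alpha\in\mathbb{R}$ are fixed parameters. A strong white noise is a sequence of independent and identically distributed real random variables. $\ln^+x=\max(\ln x,0)$. *)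

(* Defs.v *)
From HB Require Import structures.
From mathcomp Require Export all_boot all_order all_algebra.
From mathcomp Require Export all_classical all_reals all_analysis.

Set Implicit Arguments.
Unset Strict Implicit.
Unset Printing Implicit Defensive.

Export Order.TTheory GRing.Theory Num.Theory.
Export numFieldNormedType.Exports.

Open Scope classical_set_scope.
Open Scope ring_scope.

Definition product_sigma_algebra (R : realType) (I : Type) : set (set (I -> R)) :=
  <<s \bigcup_(i in [set: I])
        preimage_set_system setT (fun x : I -> R => x i) measurable >>.

Section processes.
Context {d : measure_display} {T : measurableType d} {R : realType}.
Variable P : probability T R.
Implicit Types X Y : int -> {RV P >-> R}.

Definition mutually_independent X : Prop :=
  forall (s : seq int) (B : int -> set R),
    uniq s -> (forall t, measurable (B t)) ->
    P (\bigcap_(t in [set` s]) (X t @^-1` B t))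
    = (\prod_(t <- s) P (X t @^-1` B t))%E.

Definition identically_distributed X : Prop :=
  forall (s t : int) (B : set R), measurable B ->
    distribution P (X s) B = distribution P (X t) B.

Definition strong_white_noise X : Prop :=
  mutually_independent X /\ identically_distributed X.

Definition path_of X (w : T) : int -> R := fun t => X t w.

Definition independent_processes X Y : Prop :=
  forall A B : set (int -> R),
    product_sigma_algebra A -> product_sigma_algebra B ->
    P (path_of X @^-1` A `&` path_of Y @^-1` B)
    = (P (path_of X @^-1` A) * P (path_of Y @^-1` B))%E.

Definition strictly_stationary X : Prop :=
  forall (n : nat) (t : 'I_n -> int) (h : int) (A : set ('I_n -> R)),
    product_sigma_algebra A ->
    P [set w | A (fun i => X (t i + h) w)] = P [set w | A (fun i => X (t i) w)].

Definition shift (x : int -> R) : int -> R := fun t => x (t + 1).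

Definition ergodic X : Prop :=
  forall A : set (int -> R),
    product_sigma_algebra A -> shift @^-1` A = A ->
    P (path_of X @^-1` A) = 0%E \/ P (path_of X @^-1` A) = 1%E.

Definition past_sigma_algebra X Y (t : int) : set (set T) :=
  <<s \bigcup_(s in [set s : int | s <= t])
        (preimage_set_system setT (X s) measurable
         `|` preimage_set_system setT (Y s) measurable) >>.

Definition causal_wrt eps eta X : Prop :=
  forall (t : int) (B : set R), measurable B ->
    past_sigma_algebra eps eta t (X t @^-1` B).

(* The library integral is total, with the convention +oo - +oo = -oo; this
   condition rules out that indeterminate case. *)
Definition expectation_exists (f : T -> \bar R) : Prop :=
  (\int[P]_w (f^\+ w) < +oo)%E \/ (\int[P]_w (f^\- w) < +oo)%E.

End processes.

(* lne is -oo at 0, whereas the real-valued ln is 0 there. *)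
Definition ln_abs (R : realType) (x : R) : \bar R := lne (`|x|%:E).

Definition lnplus_abs (R : realType) (x : R) : \bar R := maxe (ln_abs x) 0%E.

Section bilinear.
Context {d : measure_display} {T : measurableType d} {R : realType}.
Variable P : probability T R.
Variables theta alpha : R.
Implicit Types eps eta X : int -> {RV P >-> R}.

Definition theta_ eta (t : int) (w : T) : R :=
  theta + alpha * eta (t - 1) w + eta t w.

Definition solution_partial_sum eps eta (t : int) (w : T) (n : nat) : R :=
  \sum_(1 <= k < n)
    eps (t - k%:Z) w * \prod_(0 <= l < k) theta_ eta (t - l%:Z) w.

End bilinear.

(* Main.v *)
From HB Require Import structures.
Require Import Defs.
From mathcomp Require Import measurable_realfun ring lra zify.

(* Everything is transported to the space of joint paths (eps, eta), whose law
   is a product measure, so that the shift is mixing on cylinders and hence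
   ergodic; X is a shift-equivariant measurable function of the joint path,
   which yields stationarity and ergodicity.

   For the convergence, let Y = ln max(|theta_1|, a) + ln max(|eps_0| / L, 1) + c
   with a small, L large and c > 0 small enough that E Y < 0, and let S be the
   backward shift.  The maxima M_n of the first partial sums of Y o S^l satisfy
   M_{n+1} = max(0, Y + M_n o S), so that
   0 <= E M_{n+1} - E M_n = E max(- M_n o S, Y).
   If M_n were unbounded on a set of positive, hence full, measure, the right
   hand side would tend to E Y < 0.  So the sums of Y o S^l are almost surely
   bounded above, and the terms of the series are O(exp(- c k)). *)

Set Implicit Arguments.
Unset Strict Implicit.
Unset Printing Implicit Defensive.

(** * Ergodicity from mixing on a generating pi-system *)

Lemma measurable_preimageT d d' (T : measurableType d) (T' : measurableType d')
    (f : T -> T') A :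
  measurable_fun setT f -> measurable A -> measurable (f @^-1` A).
Proof. by move=> mf mA; rewrite -[X in measurable X]setTI; exact: mf. Qed.

Section ergodic_maps.
Context {d : measure_display} {T : measurableType d} {R : realType}.
Variables (P : probability T R) (S : T -> T).
Hypotheses (mS : measurable_fun setT S)
  (PS : forall A, measurable A -> P (S @^-1` A) = P A).

Lemma measurable_iter n : measurable_fun setT (iter n S).
Proof.
elim: n => [|n IHn] /=; first exact: measurable_id.
exact: (measurableT_comp mS IHn).
Qed.

Lemma preserving_iter n A : measurable A -> P (iter n S @^-1` A) = P A.
Proof.
elim: n A => // n IHn A mA.
rewrite -[RHS](PS mA) -[RHS]IHn//; exact: measurable_preimageT mS mA.
Qed.

Let p A := fine (P A).

Let pE A : measurable A -> P A = (p A)%:E.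
Proof. by move=> mA; rewrite /p fineK// fin_num_measure. Qed.

Let p_ge0 A : 0 <= p A.
Proof. by rewrite /p fine_ge0. Qed.

Let p_le1 A : measurable A -> p A <= 1.
Proof. by move=> mA; rewrite -lee_fin -pE// probability_le1. Qed.

Let p_le A B : measurable A -> measurable B -> A `<=` B -> p A <= p B.
Proof.
by move=> mA mB AB; rewrite -lee_fin -!pE// le_measure// inE.
Qed.

Let pD A B : measurable A -> measurable B -> B `<=` A ->
  p (A `\` B) = p A - p B.
Proof.
move=> mA mB BA; apply: EFin_inj.
rewrite -pE; last exact: measurableD.
rewrite EFinB -(pE mA) -(pE mB) measureD// ?(setIidr BA)//.
by rewrite ltey_eq fin_num_measure.
Qed.

(** Asymptotic independence from a fixed [B] passes to proper differences by additivity, and to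
    increasing unions because approximating the union by one [F k] costs an error that is uniform in
    [n]. *)
Lemma mixing_lambda_system B : measurable B ->
  lambda_system setT [set A | measurable A /\
    forall e, 0 < e -> exists N, forall n, (N <= n)%N ->
      `|p (A `&` iter n S @^-1` B) - p A * p B| <= e].
Proof.
move=> mB.
have mSB n : measurable (iter n S @^-1` B).
  exact: measurable_preimageT (measurable_iter n) mB.
have mI A n : measurable A -> measurable (A `&` iter n S @^-1` B).
  by move=> mA; exact: measurableI.
split => //=.
- split => // e e0; exists 0%N => n _.
  rewrite setTI /p preserving_iter// probability_setT /= mul1r subrr normr0.
  exact: ltW.
- move=> A A' A'A [mA hA] [mA' hA']; split; first exact: measurableD.
  move=> e e0; have e20 : 0 < e / 2 by rewrite divr_gt0.
  have [N hN] := hA _ e20; have [N' hN'] := hA' _ e20.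
  exists (maxn N N') => n; rewrite geq_max => /andP[/hN {}hN /hN' {}hN'].
  have -> : (A `\` A') `&` iter n S @^-1` B =
      (A `&` iter n S @^-1` B) `\` (A' `&` iter n S @^-1` B).
    apply/seteqP; split => x [].
      by move=> [Ax A'x] Bx; split => // -[].
    by move=> [Ax Bx] AB; split => //; split => // A'x; apply: AB.
  rewrite !pD//; [|exact: mI|exact: mI|exact: setSI].
  move: hN hN'; rewrite !ler_norml => /andP[h1 h2] /andP[h3 h4].
  apply/andP; split; lra.
- move=> F ndF hF.
  have mF n : measurable (F n) by case: (hF n).
  have mU : measurable (\bigcup_n F n) by exact: bigcup_measurable.
  split => // e e0.
  have e30 : 0 < e / 3 by rewrite divr_gt0.
  (* [k] is fixed before [N]: replacing the union by [F k] changes each of the two compared terms by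
     at most [e / 3], whatever [n]. *)
  have [k hk] : exists k, p (\bigcup_n F n) - p (F k) <= e / 3.
    have /fine_cvg : (P \o F) n @[n --> \oo] --> (p (\bigcup_n F n))%:E.
      by rewrite -pE//; exact: nondecreasing_cvg_mu.
    move=> /cvgrPdist_le /(_ _ e30)[k _ /(_ k (leqnn k))] /=.
    by move=> /ler_normlW; exists k.
  have [_ /(_ _ e30)[N hN]] := hF k.
  exists N => n Nn.
  have FkU : F k `<=` \bigcup_n F n by exact: bigcup_sup.
  have h1 : p (F k `&` iter n S @^-1` B) <= p (\bigcup_n F n `&` iter n S @^-1` B).
    by apply: p_le; [exact: mI| exact: mI| exact: setSI].
  have h2 : p (\bigcup_n F n `&` iter n S @^-1` B) - p (F k `&` iter n S @^-1` B) <= e / 3.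
    apply: le_trans hk; rewrite -!pD//; [|exact: mI|exact: mI|exact: setSI].
    apply: p_le; [by apply: measurableD; exact: mI|exact: measurableD|].
    by move=> x [[Ux Bx] nFB]; split => // Fx; apply: nFB.
  have h3 := p_le (mF k) mU FkU.
  have := hN n Nn; rewrite !ler_norml => /andP[h4 h5].
  have h6 := p_ge0 B; have h7 := p_le1 mB.
  have h8 : 0 <= (p (\bigcup_n F n) - p (F k)) * p B.
    by rewrite mulr_ge0// subr_ge0.
  have h9 : (p (\bigcup_n F n) - p (F k)) * p B <= e / 3.
    apply: le_trans hk; rewrite ler_piMr// subr_ge0//.
  apply/andP; split; lra.
Qed.

Variable G : set (set T).
Hypotheses (mG : measurable = <<s G >>) (IG : setI_closed G) (GT : G setT).
Hypothesis mixG : forall A B, G A -> G B -> exists N, forall n, (N <= n)%N ->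
  P (A `&` iter n S @^-1` B) = (P A * P B)%E.

Let Gm A : G A -> measurable A.
Proof. by move=> GA; rewrite mG; exact: sub_sigma_algebra. Qed.

(** For invariant [A], intersecting [A] with the preimage of [B] under [iter n S] gives the preimage
    of the intersection of [A] and [B]. Its probability is thus constant in [n], and the mixing
    limit becomes an equality. *)
Lemma invariant_indep A B : measurable A -> S @^-1` A = A -> G B ->
  P (A `&` B) = (P A * P B)%E.
Proof.
move=> mA invA GB; have mB := Gm GB.
have itA n : iter n S @^-1` A = A.
  by elim: n => // n IHn; rewrite -[in RHS]IHn -[in RHS]invA.
have [_ hA] : [set A | measurable A /\
    forall e, 0 < e -> exists N, forall n, (N <= n)%N ->
      `|p (A `&` iter n S @^-1` B) - p A * p B| <= e] A.
  apply: (lambda_system_subset IG (mixing_lambda_system mB)) => //.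
    move=> C GC; split; first exact: Gm.
    have [N hN] := mixG GC GB.
    move=> e e0; exists N => n Nn.
    by rewrite /p hN// fineM ?fin_num_measure ?subrr ?normr0 ?ltW//; exact: Gm.
  by rewrite -mG.
have pAB n : p (A `&` iter n S @^-1` B) = p (A `&` B).
  by rewrite -[in LHS](itA n) /p -preimage_setI preserving_iter//; exact: measurableI.
rewrite !pE//; last exact: measurableI.
congr EFin; apply/eqP; rewrite -subr_eq0 -normr_le0.
apply/ler_addgt0Pr => e /hA[N /(_ N (leqnn N))].
by rewrite pAB add0r.
Qed.

(** The restriction of [P] to [A] and the multiple [p A] of [P] agree on the pi-system [G], hence on
    all measurable sets; at [A] itself this reads [p A = p A * p A]. *)
Lemma mixing_ergodic A : measurable A -> S @^-1` A = A -> P A = 0%E \/ P A = 1%E.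
Proof.
move=> mA invA.
have pA0 : (0 <= p A)%R by [].
have : mrestr P mA A = mscale (NngNum pA0) P A.
  apply: (@measure_unique _ R T G (fun=> setT)) => //.
  - by apply/seteqP; split => // x _; exists 0%N.
  - move=> B GB; change (P (B `&` A) = (p A)%:E * P B)%E.
    by rewrite setIC invariant_indep// [in LHS](pE mA).
  - move=> k; change (P (setT `&` A) < +oo)%E.
    by rewrite setTI ltey_eq fin_num_measure.
rewrite [LHS](_ : _ = P (A `&` A))// [RHS](_ : _ = (p A)%:E * P A)%E//.
rewrite setIid (pE mA) -EFinM => -[] /eqP.
rewrite -subr_eq0 -{1}[p A]mulr1 -mulrBr.
rewrite mulf_eq0 subr_eq0 => /orP[/eqP ->|/eqP <-]; [by left|by right].
Qed.

End ergodic_maps.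

(** * Almost sure boundedness of Birkhoff sums with negative mean *)

Lemma nat_upper_bound (R : archiNumDomainType) (x : R) :
  x \is Num.real -> exists k : nat, x <= k%:R.
Proof.
move=> xr; exists (Num.bound `|x|).
exact: le_trans (real_ler_norm xr) (ltW (archi_boundP (normr_ge0 _))).
Qed.

Section birkhoff_sums.
Context {d : measure_display} {T : measurableType d} {R : realType}.
Variables (P : probability T R) (S : T -> T).
Hypotheses (mS : measurable_fun setT S)
  (PS : forall A, measurable A -> P (S @^-1` A) = P A).

Lemma ge0_integral_preserving (f : T -> \bar R) :
  measurable_fun setT f -> (forall x, 0 <= f x)%E ->
  (\int[P]_x f (S x) = \int[P]_x f x)%E.
Proof.
move=> mf f0.
have /= <- := @ge0_integral_pushforward _ _ _ _ _ _ mS P setT f measurableT mf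
  (fun x _ => f0 x).
by apply: eq_measure_integral => A mA _; exact: PS.
Qed.

Variable Y : T -> R.
Hypothesis iY : P.-integrable setT (EFin \o Y).

Let mY : measurable_fun setT Y.
Proof. exact/measurable_EFinP/(measurable_int P iY). Qed.

(** The maximum of the partial sums with 0 to [n] terms along the orbit of [x], encoded by its
    recursion because the comparison with the orbit of [S x] drives the argument. *)
Fixpoint running_max n x : R :=
  if n is m.+1 then Num.max 0 (Y x + running_max m (S x)) else 0.

Local Notation M := running_max.

Lemma running_max_ge0 n x : 0 <= M n x.
Proof. by case: n => //= n; rewrite le_max lexx. Qed.

Lemma running_max_nd m n x : (m <= n)%N -> M m x <= M n x.
Proof.
elim: m n x => [|m IHm] [|n] x //= mn; first exact: (running_max_ge0 n.+1).
by rewrite ge_max !le_max lexx/= lerD2l IHm// orbT.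
Qed.

Lemma measurable_running_max n : measurable_fun setT (M n).
Proof.
elim: n => [|n IHn]; first exact: (@measurable_cst _ _ _ _ setT (0 : R)).
apply: measurable_maxr => //; apply: measurable_funD => //.
exact: (measurableT_comp IHn mS).
Qed.

Lemma sum_le_running_max n x : \sum_(0 <= l < n) Y (iter l S x) <= M n x.
Proof.
elim: n x => [|n IHn] x; first by rewrite big_geq.
rewrite big_nat_recl//= le_max; apply/orP; right.
rewrite lerD2l; apply: le_trans (IHn (S x)).
by rewrite le_eqVlt; apply/orP; left; apply/eqP/eq_bigr => i _; rewrite -iterSr.
Qed.

Let mE n : measurable_fun setT (EFin \o M n).
Proof. exact/measurable_EFinP/measurable_running_max. Qed.

Lemma integral_running_max_comp n :
  (\int[P]_x (M n (S x))%:E = \int[P]_x (M n x)%:E)%E.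
Proof.
by apply: (@ge0_integral_preserving (EFin \o M n)) => // x;
  rewrite lee_fin running_max_ge0.
Qed.

(** By induction, since [M n.+1 x <= |Y x| + M n (S x)] and the last term has the same integral as
    [M n]. *)
Lemma integrable_running_max n : P.-integrable setT (EFin \o M n).
Proof.
apply/integrableP; split => //.
under eq_integral => x _ do rewrite /= ger0_norm ?running_max_ge0//.
elim: n => [|n IHn]; first by rewrite integral0.
apply: (@le_lt_trans _ _ (\int[P]_x (`|(Y x)%:E| + (M n (S x))%:E))%E).
  apply: ge0_le_integral => //.
  - by move=> x _; rewrite lee_fin (running_max_ge0 n.+1).
  - exact: (mE n.+1).
  - apply: emeasurable_funD; last exact: (measurableT_comp (mE n) mS).
    by apply: measurableT_comp => //; exact/measurable_EFinP.
  - move=> x _; rewrite -EFinD lee_fin ge_max lerD2r ler_norm andbT.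
    by rewrite addr_ge0// running_max_ge0.
rewrite ge0_integralD//; last 3 first.
- by apply: measurableT_comp => //; exact/measurable_EFinP.
- by move=> x _; rewrite lee_fin running_max_ge0.
- exact: (measurableT_comp (mE n) mS).
rewrite integral_running_max_comp lte_add_pinfty//.
by have /integrableP[] := iY.
Qed.

Lemma integrable_running_max_comp n :
  P.-integrable setT (fun x => (M n (S x))%:E).
Proof.
apply/integrableP; split; first exact: (measurableT_comp (mE n) mS).
under eq_integral => x _ do rewrite /= ger0_norm ?running_max_ge0//.
rewrite integral_running_max_comp.
have /integrableP[_] := integrable_running_max n.
by under eq_integral => x _ do rewrite /= ger0_norm ?running_max_ge0//.
Qed.

(** Equal to the maximum of [Y x] and [- M n (S x)]. By preservation its integral is that of
    [M n.+1 - M n], hence nonnegative. *)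
Let D n x := M n.+1 x - M n (S x).

Let D_ge0 n : (0 <= \int[P]_x (D n x)%:E)%E.
Proof.
rewrite (_ : \int[P]_x (D n x)%:E = \int[P]_x (M n.+1 x)%:E - \int[P]_x (M n x)%:E)%E.
  rewrite sube_ge0.
    apply: ge0_le_integral; [by []| |exact: mE|exact: (mE n.+1)|].
      by move=> x _; rewrite lee_fin running_max_ge0.
    by move=> x _; rewrite lee_fin running_max_nd.
  by rewrite (integrable_fin_num _ (integrable_running_max n)).
rewrite -(integral_running_max_comp n) -integralB//.
- exact: (integrable_running_max n.+1).
- exact: integrable_running_max_comp.
Qed.

Hypothesis Y_neg : (\int[P]_x (Y x)%:E < 0)%E.
Hypothesis ergS : forall A, measurable A -> S @^-1` A = A -> P A = 0%E \/ P A = 1%E.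

Definition unbounded_max : set T :=
  \bigcap_(K : nat) \bigcup_(n : nat) [set x | K%:R < M n x].

Lemma measurable_unbounded_max : measurable unbounded_max.
Proof.
apply: bigcapT_measurable => K; apply: bigcupT_measurable => n.
rewrite -[X in measurable X]setTI.
exact: measurable_fun_ltr (measurable_cst _) (measurable_running_max n) measurableT [set true] _.
Qed.

(** Up to the cut at 0, [M n.+1 x] and [M n (S x)] differ by the finite number [Y x], which a larger
    level [k] absorbs. *)
Lemma unbounded_max_invariant : S @^-1` unbounded_max = unbounded_max.
Proof.
apply/seteqP; split => x Ax K _.
  have [k hk] : exists k : nat, K%:R - Y x <= k%:R.
    exact: nat_upper_bound (num_real _).
  have [n _ /= hn] := Ax k I; exists n.+1 => //=.
  rewrite lt_max; apply/orP; right; lra.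
have [k hk] : exists k : nat, K%:R + Y x <= k%:R.
    exact: nat_upper_bound (num_real _).
have [[|n] _ /= hn] := Ax k I; first by move: hn; rewrite ltNge ler0n.
exists n => //=; move: hn; rewrite lt_max ltNge ler0n /= => hn; lra.
Qed.

Lemma unbounded_max_null : P unbounded_max = 0%E.
Proof.
have mA := measurable_unbounded_max.
have [//|PA] := ergS mA unbounded_max_invariant.
exfalso.
have [|||||_ _ cvgD] := @dominated_convergence _ _ R P setT measurableT
  (fun n => EFin \o D n) (EFin \o Y) (abse \o (EFin \o Y)).
- move=> n; apply/measurable_EFinP; apply: measurable_funB.
    exact: measurable_running_max.
  exact: (measurableT_comp (measurable_running_max n) mS).
- exact/measurable_EFinP.
(* On [unbounded_max], here of probability one, invariance makes [M n (S x)] eventually exceed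
   [- Y x]; from then on [D n x] is exactly [Y x]. *)
- exists (~` unbounded_max); split; first exact: measurableC.
    by have := probability_setC P mA; rewrite PA subee.
  apply: subsetC => x; rewrite -{1}unbounded_max_invariant => Ax _.
  apply: cvg_near_cst.
  have [k hk] : exists k : nat, - Y x <= k%:R.
    exact: nat_upper_bound (num_real _).
  have [n0 _ /= hn0] := Ax k I.
  exists n0 => // n /= n0n; rewrite /D /=.
  have := running_max_nd (S x) n0n => ?.
  by congr EFin; rewrite max_r; lra.
- exact: integrable_abse.
(* Domination by [|Y|]: either [D n x] is [Y x], or the maximum is 0 and [|D n x| = m <= - Y x]. *)
- apply: nearW => x n _; rewrite /= lee_fin /D /=.
  have := running_max_ge0 n (S x); set m := M n (S x) => m0.
  rewrite /Num.max; case: ifPn => h; last rewrite -leNgt in h.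
    by rewrite addrK.
  by rewrite sub0r normrN ger0_norm// -normrN ler_normr; lra.
have : (0 <= \int[P]_x (Y x)%:E)%E.
  rewrite -(cvg_lim _ cvgD)//; apply: lime_ge; first exact: cvgP cvgD.
  exact: nearW.
by rewrite leNgt Y_neg.
Qed.

(** The set of good points is kept invariant so that [joint_series_cvg] can treat every time [t]
    with this one set. *)
Lemma bounded_birkhoff_sums : exists A : set T,
  [/\ measurable A, P A = 1%E, S @^-1` A = A &
      forall x, A x -> exists K : R, forall n,
        \sum_(0 <= l < n) Y (iter l S x) <= K].
Proof.
exists (~` unbounded_max); split.
- exact/measurableC/measurable_unbounded_max.
- rewrite probability_setC ?unbounded_max_null ?sube0//.
  exact: measurable_unbounded_max.
- by rewrite -preimage_setC unbounded_max_invariant.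
- move=> x; rewrite /unbounded_max setC_bigcap => -[k _] h.
  exists k%:R => n; apply: le_trans (sum_le_running_max n x) _.
  rewrite leNgt; apply/negP => hn; apply: h.
  by exists n.
Qed.

End birkhoff_sums.

(** * Independent coordinates on a path space *)

Section path_space.
Variables (I : choiceType) (R : realType).

(** Built on the generators of [product_sigma_algebra], so that its measurable sets are those of the
    product sigma-algebra by conversion. *)
Definition path_space := g_sigma_algebraType
  (\bigcup_(i in [set: I])
     preimage_set_system setT (fun x : I -> R => x i) measurable).

HB.instance Definition _ := Measurable.on path_space.

Lemma measurable_path_spaceE : (measurable : set (set path_space)) =
  @product_sigma_algebra R I.
Proof. by []. Qed.

Lemma measurable_coord (i : I) :
  measurable_fun setT (fun x : path_space => x i : R).
Proof.
move=> _ B mB; rewrite measurable_path_spaceE.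
by apply: sub_sigma_algebra; exists i => //; exists B.
Qed.

Lemma measurable_to_path_space d (T : measurableType d) (f : T -> path_space) :
  (forall i, measurable_fun setT (fun w => f w i : R)) -> measurable_fun setT f.
Proof.
move=> mf; apply: (measurability _ measurable_path_spaceE).
move=> _ [_ [i _ [B mB <-]] <-]; rewrite !setTI.
by rewrite -[X in measurable X]setTI; exact: mf.
Qed.

Definition reindex (f : I -> I) (x : path_space) : path_space := fun i => x (f i).

Lemma measurable_reindex f : measurable_fun setT (reindex f).
Proof. by apply: measurable_to_path_space => i; exact: measurable_coord. Qed.

Lemma iter_reindex f n : iter n (reindex f) = reindex (iter n f).
Proof.
apply/funext => x; elim: n => //= n ->.
by apply/funext => i; rewrite /reindex -iterSr.
Qed.

Definition cylinder (s : seq I) (B : I -> set R) : set path_space :=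
  [set x | forall i, i \in s -> B i (x i)].

(** Lists are duplicate-free because a repeated index would repeat its factor in the product of
    [independent_coords]. *)
Definition cylinders : set (set path_space) :=
  [set A | exists s B, [/\ uniq s, forall i, measurable (B i) & A = cylinder s B]].

Lemma cylinder_bigcap s B :
  cylinder s B = \bigcap_(i in [set` s]) ((fun x : path_space => x i) @^-1` B i).
Proof. by []. Qed.

Lemma cylinders_setT : cylinders setT.
Proof.
exists [::], (fun=> setT); split => //.
by apply/seteqP; split.
Qed.

Lemma setI_cylinder s s' B B' : (forall i, i \in s -> i \notin s') ->
  cylinder s B `&` cylinder s' B' =
  cylinder (s ++ s') (fun i => if i \in s then B i else B' i).
Proof.
move=> ss'; apply/seteqP; split => [x [xs xs'] i|x xss'].
  by rewrite mem_cat; case: ifPn => [/xs //|_ /= /xs'].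
split => i si.
  by have := xss' i; rewrite mem_cat si; exact.
have := xss' i; rewrite mem_cat si orbT => /(_ isT).
by rewrite ifN//; apply/negP => /ss'; rewrite si.
Qed.

Lemma cylinders_setI : setI_closed cylinders.
Proof.
move=> _ _ [s [B [us mB ->]]] [s' [B' [us' mB' ->]]].
exists (undup (s ++ s')), (fun i =>
  (if i \in s then B i else setT) `&` (if i \in s' then B' i else setT)).
split; first exact: undup_uniq.
  by move=> i; apply: measurableI; case: ifP.
apply/seteqP; split => [x [xs xs'] i _|x h].
  by split; case: ifPn => //; move: i.
split => i si.
  by have := h i; rewrite mem_undup mem_cat si => /(_ isT)[].
by have := h i; rewrite mem_undup mem_cat si orbT => /(_ isT)[].
Qed.

Lemma measurable_cylinder s B : (forall i, measurable (B i)) ->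
  measurable (cylinder s B).
Proof.
move=> mB; rewrite cylinder_bigcap.
apply: fin_bigcap_measurable => // i _.
by rewrite -[X in measurable X]setTI; exact: measurable_coord.
Qed.

Lemma measurable_cylinders : (measurable : set (set path_space)) = <<s cylinders >>.
Proof.
apply/seteqP; split.
  rewrite measurable_path_spaceE; apply: sub_sigma_algebra2.
  move=> _ [i _ [B mB <-]]; exists [:: i], (fun=> B); split => //.
  apply/seteqP; split => x.
    by move=> [_ Bx] j; rewrite inE => /eqP ->.
  by move=> h; split => //; apply: (h i); rewrite inE.
apply: smallest_sub; first exact: sigma_algebra_measurable.
by move=> _ [s [B [_ mB ->]]]; exact: measurable_cylinder.
Qed.

(** The left inverse [g] recovers, from an index [f i], the index [i] whose constraint applies
    there. *)
Lemma reindex_cylinder f g s B : cancel f g ->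
  reindex f @^-1` cylinder s B = cylinder (map f s) (B \o g).
Proof.
move=> fK; apply/seteqP; split => x h.
  by move=> _ /mapP[i si ->] /=; rewrite fK; exact: h.
by move=> i si; have := h _ (map_f f si); rewrite /= fK.
Qed.

Variable Q : probability path_space R.

Definition independent_coords := forall s B, uniq s ->
  (forall i, measurable (B i)) ->
  Q (cylinder s B) = (\prod_(i <- s) Q [set x : path_space | B i (x i)])%E.

(** A condition on one-dimensional marginals; together with [independent_coords] it gives invariance
    of the whole law, in [reindex_preserving]. *)
Definition law_invariant f := forall i (B : set R), measurable B ->
  Q [set x : path_space | B (x (f i))] = Q [set x : path_space | B (x i)].

Hypothesis Qindep : independent_coords.

Lemma reindex_cylinder_law f g s B : cancel f g -> law_invariant f ->
  uniq s -> (forall i, measurable (B i)) ->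
  Q (cylinder (map f s) (B \o g)) = Q (cylinder s B).
Proof.
move=> fK fQ us mB; rewrite !Qindep//; last 2 first.
- by rewrite map_inj_uniq//; exact: can_inj fK.
- by move=> i; exact: mB.
by rewrite big_map; apply: eq_bigr => i _; rewrite /= fK fQ.
Qed.

Lemma reindex_preserving f g : cancel f g -> law_invariant f ->
  forall A, measurable A -> Q (reindex f @^-1` A) = Q A.
Proof.
move=> fK fQ A mA.
pose mf : {mfun path_space >-> path_space} :=
  HB.pack (reindex f) (isMeasurableFun.Build _ _ _ _ _ (measurable_reindex f)).
apply: (@measure_unique _ R path_space cylinders (fun=> setT) measurable_cylinders
  cylinders_setI (fun=> cylinders_setT) _ (distribution Q mf) Q) => //.
- by apply/seteqP; split => // x _; exists 0%N.
- move=> _ [s [B [us mB ->]]].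
  rewrite [LHS](_ : _ = Q (reindex f @^-1` cylinder s B))//.
  by rewrite (reindex_cylinder _ _ fK) reindex_cylinder_law.
- by move=> _; rewrite ltey_eq fin_num_measure.
Qed.

(** Iterates of [f] eventually separate two finite index sets, so two cylinders end up with disjoint
    supports and are then exactly independent, as [mixing_ergodic] requires. *)
Lemma reindex_ergodic f g : cancel f g -> law_invariant f ->
  (forall s s' : seq I, exists N, forall n, (N <= n)%N ->
     forall i, i \in s' -> iter n f i \notin s) ->
  forall A, measurable A -> reindex f @^-1` A = A -> Q A = 0%E \/ Q A = 1%E.
Proof.
move=> fK fQ fmix; apply: (mixing_ergodic (measurable_reindex f)
  (reindex_preserving fK fQ) measurable_cylinders cylinders_setI cylinders_setT).
move=> _ _ [s [B [us mB ->]]] [s' [B' [us' mB' ->]]].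
have [N hN] := fmix s s'; exists N => n Nn.
have itK : cancel (iter n f) (iter n g).
  by elim: n {Nn} => // n IHn i; rewrite iterSr iterS fK IHn.
have itQ : law_invariant (iter n f).
  move=> i C mC; elim: n {Nn itK} => // n IHn.
  by rewrite -IHn -(fQ (iter n f i)).
rewrite iter_reindex (reindex_cylinder _ _ itK) setI_cylinder; last first.
  move=> i si; apply/negP => /mapP[j s'j ij].
  by have /negP := hN n Nn j s'j; apply; rewrite -ij.
rewrite Qindep; last 2 first.
- rewrite cat_uniq us map_inj_uniq ?us' ?andbT//=; last exact: can_inj itK.
  by apply/hasPn => _ /mapP[j s'j ->]; exact: hN.
- by move=> i; case: ifP => // _; exact: mB'.
rewrite big_cat/= (Qindep us mB) -(reindex_cylinder_law itK itQ us' mB').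
rewrite Qindep; last 2 first.
- by rewrite map_inj_uniq//; exact: can_inj itK.
- by move=> i; exact: mB'.
congr (_ * _)%E; apply: eq_big_seq => i.
  by move=> ->.
by move=> /mapP[j s'j ->]; rewrite ifN//; exact: hN.
Qed.

End path_space.

(** * Truncation of the logarithmic moments *)

Section log_moments.
Context {d : measure_display} {T : measurableType d} {R : realType}.
Variable P : probability T R.

Lemma measurable_lne_abs (U : T -> R) : measurable_fun setT U ->
  measurable_fun setT (fun w => ln_abs (U w)).
Proof.
move=> mU.
have mabsU : measurable_fun setT (fun w => `|U w|) by exact: measurableT_comp.
apply: (@measurable_fun_ifT _ _ _ _ (cst -oo%E) (fun w => (ln `|U w|)%:E)
  (fun w => `|U w| <= 0)).
- by apply: measurable_fun_ler => //; exact: measurable_cst.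
- exact: measurable_cst.
- by apply/measurable_EFinP; exact: measurableT_comp.
Qed.

Lemma measurable_ln_max_abs (U : T -> R) a : measurable_fun setT U ->
  measurable_fun setT (fun w => ln (Num.max `|U w| a)).
Proof.
move=> mU; apply: measurableT_comp => //.
by apply: measurable_maxr => //; exact: measurableT_comp.
Qed.

(** Truncating inside the logarithm at [expR r] truncates the logarithm at [r]; at [x = 0], where
    [ln_abs] is [-oo], both sides are [r]. *)
Lemma ln_max_absE (x r : R) :
  (ln (Num.max `|x| (expR r)))%:E = maxe (ln_abs x) r%:E.
Proof.
rewrite /ln_abs /lne; case: ifPn => [x0|].
  rewrite maxNye; congr EFin.
  by rewrite max_r ?expRK// (le_trans x0)// expR_ge0.
rewrite -ltNge => x0; rewrite -EFin_max; congr EFin.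
have [h|h] := leP `|x| (expR r).
  by rewrite expRK max_r// -(expRK r) ler_ln// posrE expR_gt0.
by rewrite max_l// -(expRK r) ler_ln ?posrE ?expR_gt0// ltW.
Qed.

(** The negative part of the logarithm may have an infinite integral. By monotone convergence its
    truncation at some [n] still outweighs the positive part, and this truncation is realized by a
    floor [a] under [|U|]. *)
Lemma truncated_log_neg (U : T -> R) : measurable_fun setT U ->
  expectation_exists P (fun w => ln_abs (U w)) ->
  (\int[P]_w ln_abs (U w) < 0)%E ->
  exists2 a : R, 0 < a &
    P.-integrable setT (fun w => (ln (Num.max `|U w| a))%:E) /\
    (\int[P]_w (ln (Num.max `|U w| a))%:E < 0)%E.
Proof.
move=> mU exU; set f := fun w => ln_abs (U w).
have mf : measurable_fun setT f by exact: measurable_lne_abs.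
rewrite integralE => fneg.
have pos_ge0 := integral_ge0 P (fun w (_ : setT w) => funepos_ge0 f w).
have neg_ge0 := integral_ge0 P (fun w (_ : setT w) => funeneg_ge0 f w).
(* Otherwise the negative part would have a finite integral, and the mean would be [+oo] instead of
   negative. *)
have pos_fin : (\int[P]_w f^\+ w < +oo)%E.
  case: exU => // neg_fin; rewrite ltNge leye_eq; apply/negP => /eqP pos_oo.
  by move: fneg; rewrite pos_oo addye ?eqe_oppLR ?lt_eqF.
have pos_lt_neg : (\int[P]_w f^\+ w < \int[P]_w f^\- w)%E.
  by rewrite -sube_lt0// ge0_fin_numE// pos_fin.
pose g n w := mine (f^\- w)%E n%:R%:E.
have mg n : measurable_fun setT (g n).
  by apply: measurable_mine => //; exact: measurable_funeneg.
have g_ge0 n w : (0 <= g n w)%E by rewrite le_min funeneg_ge0 lee_fin ler0n.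
have g_cvg w : limn (g ^~ w) = (f^\- w)%E.
  apply/cvg_lim => //.
  have := funeneg_ge0 f w; rewrite /g; case: (f^\- w)%E => [r r0| _|//].
    apply: cvg_near_cst; near=> n; rewrite min_l// lee_fin.
    by near: n; exact: nbhs_infty_ger.
  under eq_cvg => n do rewrite min_r ?leey//.
  exact/cvgeryP/cvgr_idn.
have [n hn] : exists n, (\int[P]_w f^\+ w < \int[P]_w g n w)%E.
  apply: contrapT => /forallNP h.
  have gnd w : setT w -> {homo g ^~ w : n m / (n <= m)%N >-> (n <= m)%E}.
    move=> _ n m nm; rewrite /g le_min ge_min lexx/= ge_min.
    by rewrite lee_fin ler_nat nm orbT.
  have cg := cvg_monotone_convergence (mu := P) measurableT mg
    (fun n w _ => g_ge0 n w) gnd.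
  move: pos_lt_neg; rewrite ltNge => /negP; apply.
  under eq_integral => w _ do rewrite -g_cvg.
  rewrite -(cvg_lim _ cg)//; apply: lime_le; first exact: cvgP cg.
  by apply: nearW => n; rewrite leNgt; apply/negP/h.
(* With this floor the logarithm becomes [max(f, - n)], which is the positive part of [f] minus
   [g n]. *)
exists (expR (- n%:R)); first exact: expR_gt0.
have ln_maxE w : (ln (Num.max `|U w| (expR (- n%:R))))%:E = (f^\+ w - g n w)%E.
  rewrite ln_max_absE -/(f w) /g funeposE funenegE.
  have n0 : (0 : R) <= n%:R by rewrite ler0n.
  case: (f w) => [r| |].
  - rewrite /= -!EFin_max -EFin_min -EFinB; congr EFin.
    have [r0|r0] := leP 0 r.
      by rewrite max_l 1?(max_r (_ : - r <= 0)) ?min_l ?subr0//; lra.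
    by rewrite (max_l (_ : 0 <= - r)) ?oppr_min ?opprK ?sub0r//; lra.
  - rewrite max_l ?leey// max_l ?leey// max_r ?leNye//.
    by rewrite min_l ?sube0// lee_fin.
  - by rewrite !maxNye/= add0e.
have ipos : P.-integrable setT (f^\+)%E.
  apply/integrableP; split; first exact: measurable_funepos.
  by under eq_integral => w _ do rewrite gee0_abs ?funepos_ge0//.
have ig : P.-integrable setT (g n).
  apply: (@le_integrable _ _ _ P setT measurableT _ (cst n%:R%:E)) => //.
    move=> w _; rewrite gee0_abs ?g_ge0//= ger0_norm// ge_min lexx orbT//.
  exact: finite_measure_integrable_cst.
split.
  by under eq_fun do rewrite ln_maxE; exact: integrableB.
under eq_integral => w _ do rewrite ln_maxE.
by rewrite integralB// sube_lt0// ge0_fin_numE// pos_fin.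
Unshelve. all: by end_near. Qed.

(** For [L = expR n] the integrand is the positive part of [ln |W| - n]. It tends to 0 and is
    dominated by its value at [n = 0], the integrable [lnplus_abs]. *)
Lemma log_tail_small (W : T -> R) e : measurable_fun setT W ->
  (\int[P]_w lnplus_abs (W w) < +oo)%E -> 0 < e ->
  exists2 L : R, 0 < L &
    P.-integrable setT (fun w => (ln (Num.max `|W w| L) - ln L)%:E) /\
    (\int[P]_w (ln (Num.max `|W w| L) - ln L)%:E < e%:E)%E.
Proof.
move=> mW intW e0.
have lnp w : lnplus_abs (W w) = (ln (Num.max `|W w| (expR 0)))%:E.
  by rewrite ln_max_absE.
pose v n w : R := ln (Num.max `|W w| (expR n%:R)) - n%:R.
have v_ge0 n w : 0 <= v n w.
  by rewrite subr_ge0 -{1}(expRK n%:R) ler_ln ?posrE ?lt_max ?expR_gt0 ?orbT// le_max lexx orbT.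
have v_le n w : v n w <= v 0 w.
  have n0 : (0 : R) <= n%:R by rewrite ler0n.
  rewrite /v mulr0n subr0 -lee_fin EFinB !ln_max_absE.
  case: (ln_abs _) => [r| |].
  - rewrite -!EFin_max -EFinB lee_fin lerBlDr ge_max.
    have [r0|r0] := leP r 0; apply/andP; split; lra.
  - by rewrite leye_eq.
  - by rewrite !maxNye lee_fin subrr.
have mv n : measurable_fun setT (v n).
  by apply: measurable_funB; [exact: measurable_ln_max_abs|exact: measurable_cst].
have iv0 : P.-integrable setT (EFin \o v 0).
  apply/integrableP; split; first exact/measurable_EFinP.
  rewrite (eq_integral (fun w => lnplus_abs (W w)))// => w _.
  by rewrite lnp gee0_abs ?lee_fin ?v_ge0//= /v mulr0n subr0.
have [|||||_ _] := @dominated_convergence _ _ R P setT measurableT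
  (fun n => EFin \o v n) (cst 0%E) (EFin \o v 0).
- by move=> n; exact/measurable_EFinP.
- exact: measurable_cst.
(* The sequence is eventually zero, as [|W w| <= 1 + n <= expR n] for large [n]. *)
- apply: nearW => w _; apply: cvg_near_cst; near=> n.
  rewrite /= /v max_r ?expRK ?subrr//.
  apply: (@le_trans _ _ (1 + n%:R)); last exact: expR_ge1Dx.
  rewrite -lerBlDl; near: n; exact: nbhs_infty_ger.
- by [].
- by apply: nearW => w n _; rewrite /= lee_fin ger0_norm.
rewrite integral0 => cv.
have [n hn] : exists n, (\int[P]_w (v n w)%:E < e%:E)%E.
  apply: contrapT => /forallNP h.
  have : (e%:E <= 0)%E.
    rewrite -(cvg_lim _ cv)//; apply: lime_ge; first exact: cvgP cv.
    by apply: nearW => n; rewrite leNgt; apply/negP/h.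
  by rewrite lee_fin leNgt e0.
exists (expR n%:R); first exact: expR_gt0.
rewrite expRK; split => //.
apply: (@le_integrable _ _ _ P setT measurableT _ (EFin \o v 0)) => //.
  exact/measurable_EFinP/(mv n).
by move=> w _; rewrite /= lee_fin -/(v n w) !ger0_norm ?v_ge0 ?v_le.
Unshelve. all: by end_near. Qed.

Lemma log_drift (U W : T -> R) : measurable_fun setT U -> measurable_fun setT W ->
  expectation_exists P (fun w => ln_abs (U w)) ->
  (\int[P]_w ln_abs (U w) < 0)%E ->
  (\int[P]_w lnplus_abs (W w) < +oo)%E ->
  exists a L c : R, [/\ 0 < a, 0 < L, 0 < c,
    P.-integrable setT (fun w => (ln (Num.max `|U w| a) +
       (ln (Num.max `|W w| L) - ln L) + c)%:E) &
    (\int[P]_w (ln (Num.max `|U w| a) +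
       (ln (Num.max `|W w| L) - ln L) + c)%:E < 0)%E].
Proof.
move=> mU mW exU Uneg Wfin.
have [a a0 [iU intU]] := truncated_log_neg mU exU Uneg.
have := integrable_fin_num measurableT iU.
move: intU; case E : (integral _ _ _) => [r| |]//; rewrite lte_fin => r0 _.
have r20 : 0 < - r / 2 by rewrite divr_gt0// oppr_gt0.
have [L L0 [iW intW]] := log_tail_small mW Wfin r20.
(* The truncated mean [r < 0] leaves room [- r]: one half bounds the noise term strictly, the other
   half is [c], later the geometric rate. *)
exists a, L, (- r / 2).
have ic : P.-integrable setT (EFin \o cst (- r / 2)).
  exact: finite_measure_integrable_cst.
have iUW := integrableD measurableT iU iW.
split => //.
  exact: (integrableD measurableT iUW ic).
rewrite [X in (X < _)%E](integralD measurableT iUW ic).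
rewrite (integralD measurableT iU iW) E.
rewrite [X in (_ + X)%E](integral_cst P measurableT (- r / 2)%:E).
rewrite [X in (_ + _ * X)%E](_ : _ = 1%E); last exact: probability_setT.
rewrite mule1; move: intW; case: (integral _ _ _) => [x| |]//.
  by rewrite -!EFinD !lte_fin; lra.
by rewrite addeNy addNye ltNyr.
Qed.

End log_moments.

(** * The series along a fixed path *)

Section pathwise_solution.
Variables (R : realType) (theta alpha : R).
Implicit Types (e h : int -> R) (t : int).

Definition path_coef h t : R := theta + alpha * h (t - 1) + h t.

Definition path_sum e h t (n : nat) : R :=
  \sum_(1 <= k < n) e (t - k%:Z) * \prod_(0 <= l < k) path_coef h (t - l%:Z).

(* The superior limit makes path_sol total and measurable; it is the sum of the
   series wherever the latter converges. *)
Definition path_sol e h t : R :=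
  e t + fine (limn_esup (fun n => (path_sum e h t n)%:E)).

Lemma path_solE e h t : cvgn (path_sum e h t) ->
  path_sol e h t = e t + limn (path_sum e h t).
Proof.
move=> cv; rewrite /path_sol.
have cvE : (path_sum e h t n)%:E @[n --> \oo] --> (limn (path_sum e h t))%:E.
  by apply: cvg_EFin => //; exact: nearW.
by rewrite is_cvg_limn_esupE; [rewrite (cvg_lim _ cvE)|exact: cvgP cvE].
Qed.

Lemma path_sum_shift e h s t n :
  path_sum (fun u => e (u + s)) (fun u => h (u + s)) t n = path_sum e h (t + s) n.
Proof.
apply: eq_bigr => k _; congr (e _ * _); first by rewrite addrAC.
apply: eq_bigr => l _; rewrite /path_coef.
have -> : t - l%:Z - 1 + s = t + s - l%:Z - 1 by lia.
by have -> : t - l%:Z + s = t + s - l%:Z by lia.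
Qed.

Lemma path_sol_shift e h s t :
  path_sol (fun u => e (u + s)) (fun u => h (u + s)) t = path_sol e h (t + s).
Proof.
rewrite /path_sol; congr (_ + fine (limn_esup _)).
by apply/funext => n; rewrite path_sum_shift.
Qed.

(** Every product has the factor [path_coef h t] at [l = 0]. The sums start at [k = 1], so the first
    term provides the [e (t - 1)] missing from the sum at [t - 1]. *)
Lemma path_sum_rec e h t n :
  path_sum e h t n.+2 = path_coef h t * (e (t - 1) + path_sum e h (t - 1) n.+1).
Proof.
rewrite /path_sum big_nat_recl// big_nat1 subr0 [RHS]mulrDr mulr_sumr.
congr (_ + _); first exact: mulrC.
apply: eq_big_nat => k _; rewrite big_nat_recl// subr0 mulrCA.
have -> : t - k.+1%:Z = t - 1 - k%:Z by lia.
congr (_ * (_ * _)); apply: eq_bigr => l _.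
by have -> : t - l.+1%:Z = t - 1 - l%:Z by lia.
Qed.

Lemma path_sol_rec e h t :
  cvgn (path_sum e h t) -> cvgn (path_sum e h (t - 1)) ->
  path_sol e h t = path_coef h t * path_sol e h (t - 1) + e t.
Proof.
move=> cv cv1; rewrite !path_solE// addrC; congr (_ + _).
apply/cvg_lim => //; rewrite -cvg_shiftS -cvg_shiftS /=.
under eq_cvg => n do rewrite path_sum_rec.
apply: cvgMr; apply: cvgD; first exact: cvg_cst.
by rewrite (cvg_shiftS (path_sum e h (t - 1))).
Qed.

(** The bound [K] on the logarithmic sums makes the [k]-th term of the series at most a constant
    times [expR (- c) ^+ k]. *)
Lemma path_sum_cvg e h t (a L c K : R) : 0 < a -> 0 < L -> 0 < c ->
  (forall n, \sum_(0 <= l < n)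
     (ln (Num.max `|path_coef h (t + 1 - l%:Z)| a) +
      (ln (Num.max `|e (t - l%:Z)| L) - ln L) + c) <= K) ->
  cvgn (path_sum e h t).
Proof.
move=> a0 L0 c0 hK.
pose u k := e (t - k%:Z) * \prod_(0 <= l < k) path_coef h (t - l%:Z).
have lnmax_ge (x b : R) : 0 < b -> ln b <= ln (Num.max `|x| b).
  by move=> b0; rewrite ler_ln ?posrE ?lt_max ?b0 ?orbT// le_max lexx orbT.
have lnmaxK (x b : R) : 0 < b -> `|x| <= expR (ln (Num.max `|x| b)).
  by move=> b0; rewrite lnK ?posrE ?lt_max ?b0 ?orbT// le_max lexx.
have hu k : `|u k| <= expR (K - ln a + ln L) * expR (- c) ^+ k.
  (* These [k + 1] terms involve the coefficients at times [t + 1] down to [t + 1 - k] and the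
     noises at [t] down to [t - k]. The coefficient at [t + 1], absent from [u k], contributes at
     least [ln a]; the noises before the last contribute at least 0. *)
  have := hK k.+1.
  rewrite 2!big_split/= sumr_const_nat subn0.
  rewrite big_nat_recl// subr0.
  have := lnmax_ge (path_coef h (t + 1)) a a0.
  rewrite [\sum_(0 <= i < k.+1) (_ - _)]big_nat_recr//=.
  have : 0 <= \sum_(0 <= i < k) (ln (Num.max `|e (t - i%:Z)| L) - ln L).
    by apply: sumr_ge0 => i _; rewrite subr_ge0 lnmax_ge.
  set B := \sum_(0 <= i < k) (_ - _); set A0 := ln (Num.max `|path_coef _ _| a).
  set A := \sum_(0 <= i < k) _; set b := ln (Num.max `|e _| L).
  move=> B0 A00; rewrite mulrS => hs.
  apply: (@le_trans _ _ (expR b * expR A)).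
    rewrite normrM ler_pM// ?lnmaxK// normr_prod /A expR_sum.
    apply: ler_prod => i _; rewrite normr_ge0/=.
    by apply: le_trans (lnmaxK _ _ a0) _; rewrite (_ : t + 1 - i.+1%:Z = t - i%:Z)//; lia.
  rewrite -expRM_natl -!expRD ler_expR.
  rewrite mulrN -mulr_natl in hs *; lra.
have cvu : cvgn (series u).
  apply: normed_cvg; apply: (@series_le_cvg _ _
    (geometric (expR (K - ln a + ln L)) (expR (- c)))) => //=.
  apply: is_cvg_geometric_series; rewrite ger0_norm ?expR_ge0//.
  by rewrite expR_lt1 oppr_lt0.
(* [path_sum] starts at [k = 1], so it is the series without [u 0], for positive [n] only. *)
have cvu0 : series u n - u 0%N @[n --> \oo] --> limn (series u) - u 0%N.
  by apply: cvgB => //; exact: cvg_cst.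
apply: (cvgP (limn (series u) - u 0%N)); apply: cvg_trans cvu0.
apply: near_eq_cvg; near=> n.
have n0 : (0 < n)%N by near: n; exact: nbhs_infty_gt.
by rewrite /path_sum /series /= (big_ltn n0) [u 0%N + _]addrC addrK.
Unshelve. all: by end_near. Qed.

(** Measurability is asked of the noises up to time [t], so that the same fact yields both
    measurability on the path space and causality. *)
Lemma measurable_path_sol d (T : measurableType d) (e h : int -> T -> R) t :
  (forall s, s <= t -> measurable_fun setT (e s)) ->
  (forall s, s <= t -> measurable_fun setT (h s)) ->
  measurable_fun setT (fun w => path_sol (e ^~ w) (h ^~ w) t).
Proof.
move=> me mh; apply: measurable_funD; first exact: me.
apply: measurableT_comp; first exact: fine_measurable.
apply: measurable_fun_limn_esup => n; apply/measurable_EFinP.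
apply: measurable_sum => k; apply: measurable_funM; first by apply: me; lia.
apply: measurable_prod => l _.
apply: measurable_funD; last by apply: mh; lia.
apply: measurable_funD; first exact: measurable_cst.
by apply: measurable_funM; [exact: measurable_cst|apply: mh; lia].
Qed.

End pathwise_solution.

(** * The causal stationary solution *)

(** One index set carries both noises: the boolean selects the noise, [true] for [eps], and both
    move in time together. *)
Definition time_shift (s : int) (i : bool * int) : bool * int := (i.1, i.2 + s).

Lemma time_shiftK s : cancel (time_shift s) (time_shift (- s)).
Proof. by case=> b t; rewrite /time_shift /= addrK. Qed.

Lemma iter_time_shift s n i :
  iter n (time_shift s) i = time_shift (s * n%:Z) i.
Proof.
elim: n => [|n IHn]; first by rewrite mulr0 /time_shift addr0; case: i.
by rewrite iterS IHn /time_shift /=; congr (_, _); lia.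
Qed.

Lemma time_shift_disjoint (s s' : seq (bool * int)) : exists N, forall n,
  (N <= n)%N -> forall i, i \in s' -> iter n (time_shift (-1)) i \notin s.
Proof.
have bnd (r : seq (bool * int)) : exists m : nat, forall i, i \in r -> (`|i.2| <= m)%N.
  elim: r => [|j r [m IHr]]; first by exists 0%N.
  exists (maxn `|j.2|%N m) => i; rewrite inE leq_max => /orP[/eqP ->|/IHr ->].
    by rewrite leqnn.
  by rewrite orbT.
have [m hm] := bnd s; have [m' hm'] := bnd s'.
(* More than [m + m'] steps backward move times in [[- m', m']] below [- m]. *)
exists (m + m').+1 => n hn i /hm' im'; apply/negP => /hm.
rewrite iter_time_shift /time_shift /=; move: i.2 im' => u im'; lia.
Qed.

(** * The law of the joint path of the two noises *)

Section joint_path.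
Context {d : measure_display} {T : measurableType d} {R : realType}.
Variables (P : probability T R) (eps eta : int -> {RV P >-> R}).

Definition joint_path (w : T) : path_space (bool * int)%type R :=
  fun i => if i.1 then eps i.2 w else eta i.2 w.

Lemma measurable_joint_path : measurable_fun setT joint_path.
Proof.
apply: measurable_to_path_space => -[[] t]; exact: measurable_funPT.
Qed.

HB.instance Definition _ :=
  isMeasurableFun.Build _ _ _ _ joint_path measurable_joint_path.

Let Q := distribution P (joint_path : {mfun T >-> path_space (bool * int)%type R}).

Lemma noise_cylinder (X : int -> {RV P >-> R}) (s : seq int) B :
  mutually_independent X -> uniq s -> (forall t, measurable (B t)) ->
  P (path_of X @^-1` cylinder s B) = (\prod_(t <- s) P (X t @^-1` B t))%E.
Proof. by move=> Xind us mB; rewrite -Xind. Qed.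

(** A joint cylinder splits by the boolean into an [eps] part and an [eta] part; independence of the
    processes separates the two, and each noise then factors over its own times. *)
Lemma joint_path_indep : mutually_independent eps -> mutually_independent eta ->
  independent_processes eps eta -> independent_coords Q.
Proof.
move=> ieps ieta iee s B us mB.
pose sel b := [seq i.2 | i <- s & i.1 == b].
have usel b : uniq (sel b).
  rewrite map_inj_in_uniq ?filter_uniq// => -[b1 t1] [b2 t2].
  by rewrite !mem_filter /= => /andP[/eqP -> _] /andP[/eqP -> _] ->.
transitivity (P (path_of eps @^-1` cylinder (sel true) (fun t => B (true, t)) `&`
       path_of eta @^-1` cylinder (sel false) (fun t => B (false, t)))).
  congr (P _); apply/seteqP; split => w.
    move=> h; split => t /mapP[[b u]]; rewrite mem_filter /= => /andP[/eqP -> si] ->.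
      exact: (h (true, u)).
    exact: (h (false, u)).
  move=> [h1 h0] [[] t] si; [apply: h1|apply: h0];
    by apply/mapP; eexists; [rewrite mem_filter; apply/andP; split; last exact: si|].
rewrite iee; try by rewrite -measurable_path_spaceE; apply: measurable_cylinder => t.
rewrite !noise_cylinder//.
rewrite [RHS](bigID (fun i => i.1 == true))/=.
rewrite !big_map !big_filter; congr (_ * _)%E.
  by apply: eq_bigr => -[b t] /= /eqP ->.
by apply: eq_big => [[[] t]|[b t] /= /eqP ->].
Qed.

Lemma joint_path_stationary s : identically_distributed eps ->
  identically_distributed eta -> law_invariant Q (time_shift s).
Proof. by move=> deps deta [[] t] B mB; [exact: deps|exact: deta]. Qed.

End joint_path.

(** * The solution as a shift-equivariant function of the joint path *)

Section causal_solution.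
Context {d : measure_display} {T : measurableType d} {R : realType}.
Variables (P : probability T R) (theta alpha : R) (eps eta : int -> {RV P >-> R}).

Local Notation Om := (path_space (bool * int)%type R).
Local Notation Z := (@joint_path _ _ _ P eps eta).
Local Notation Q := (distribution P (Z : {mfun T >-> Om})).

Definition eps_path (x : Om) (t : int) : R := x (true, t).
Definition eta_path (x : Om) (t : int) : R := x (false, t).

Definition joint_sol (x : Om) (t : int) : R :=
  path_sol theta alpha (eps_path x) (eta_path x) t.

(** This equivariance carries stationarity and ergodicity from the joint path to the solution. *)
Lemma joint_sol_shift x s t :
  joint_sol (reindex (time_shift s) x) t = joint_sol x (t + s).
Proof. exact: path_sol_shift. Qed.

Lemma measurable_joint_sol t : measurable_fun setT (joint_sol ^~ t).
Proof.
exact: (@measurable_path_sol R theta alpha _ Om (fun t x => eps_path x t)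
  (fun t x => eta_path x t) t (fun s _ => measurable_coord _)
  (fun s _ => measurable_coord _)).
Qed.

Definition solution (t : int) (w : T) : R := joint_sol (Z w) t.

Lemma measurable_solution t : measurable_fun setT (solution t).
Proof.
exact: (measurableT_comp (measurable_joint_sol t) (measurable_joint_path eps eta)).
Qed.

HB.instance Definition _ t :=
  isMeasurableFun.Build _ _ _ _ (solution t) (measurable_solution t).

Definition solution_rv (t : int) : {RV P >-> R} := solution t.

Hypothesis eps_swn : strong_white_noise eps.
Hypothesis eta_swn : strong_white_noise eta.
Hypothesis eps_eta_indep : independent_processes eps eta.

Lemma joint_shift_preserving s A : measurable A ->
  Q (reindex (time_shift s) @^-1` A) = Q A.
Proof.
have [[ieps deps] [ieta deta]] := (eps_swn, eta_swn).
apply: (reindex_preserving (joint_path_indep ieps ieta eps_eta_indep) (@time_shiftK s)).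
exact: joint_path_stationary.
Qed.

Lemma joint_shift_ergodic A : measurable A ->
  reindex (time_shift (-1)) @^-1` A = A -> Q A = 0%E \/ Q A = 1%E.
Proof.
have [[ieps deps] [ieta deta]] := (eps_swn, eta_swn).
apply: (reindex_ergodic (joint_path_indep ieps ieta eps_eta_indep)
  (@time_shiftK (-1)) _ time_shift_disjoint).
exact: joint_path_stationary.
Qed.

(** [T] is equipped with the past sigma-algebra and [measurable_path_sol] is applied there;
    [path_sol] being total, no exceptional null set arises. *)
Lemma solution_causal : causal_wrt eps eta solution_rv.
Proof.
move=> t B mB.
pose G := \bigcup_(s in [set s : int | s <= t])
        (preimage_set_system setT (eps s) measurable
         `|` preimage_set_system setT (eta s) measurable).
have meps s : s <= t -> measurable_fun setT (eps s : g_sigma_algebraType G -> R).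
  by move=> st _ C mC; apply: sub_sigma_algebra; exists s => //; left; exists C.
have meta s : s <= t -> measurable_fun setT (eta s : g_sigma_algebraType G -> R).
  by move=> st _ C mC; apply: sub_sigma_algebra; exists s => //; right; exists C.
have := measurable_path_sol theta alpha meps meta.
by move=> /(_ measurableT B mB); rewrite setTI.
Qed.

Lemma solution_stationary : strictly_stationary solution_rv.
Proof.
move=> n t h A; rewrite -measurable_path_spaceE => mA.
pose F (x : Om) : path_space 'I_n R := fun i => joint_sol x (t i).
have mF : measurable_fun setT F.
  by apply: measurable_to_path_space => i; exact: measurable_joint_sol.
have mFA : measurable (F @^-1` A) by exact: measurable_preimageT mF mA.
apply: etrans (joint_shift_preserving h mFA).
have FE x : F (reindex (time_shift h) x) = (fun i => joint_sol x (t i + h)).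
  by apply/funext => i; exact: joint_sol_shift.
congr (P _); apply/funext => w.
by rewrite -[RHS]/(A (F (reindex (time_shift h) (Z w)))) FE.
Qed.

Lemma solution_ergodic : ergodic solution_rv.
Proof.
move=> A; rewrite -measurable_path_spaceE => mA shA.
pose F (x : Om) : path_space int R := joint_sol x.
have mF : measurable_fun setT F.
  by apply: measurable_to_path_space => i; exact: measurable_joint_sol.
apply: (@joint_shift_ergodic (F @^-1` A)); first exact: measurable_preimageT mF mA.
(* The forward shift of the solution undoes the backward shift of the joint path, so a
   shift-invariant [A] has an invariant preimage under [F]. *)
have FE x : shift (F (reindex (time_shift (-1)) x)) = F x.
  by apply/funext => t; rewrite /shift /F joint_sol_shift addrK.
by rewrite -[in LHS]shA; apply/funext => x; rewrite /= FE.
Qed.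

Hypothesis eps_log_moment : (\int[P]_w lnplus_abs (eps 0%R w) < +oo)%E.
Hypothesis coef_log_exists : expectation_exists P
  (fun w => ln_abs (theta + alpha * eta 0 w + eta 1 w)).
Hypothesis coef_log_neg :
  (\int[P]_w ln_abs (theta + alpha * eta 0%R w + eta 1%R w)%R < 0)%E.

Lemma joint_series_cvg : exists A : set Om, [/\ measurable A, Q A = 1%E &
  forall x, A x -> forall t, cvgn (path_sum theta alpha (eps_path x) (eta_path x) t)].
Proof.
pose U (w : T) := theta + alpha * eta 0 w + eta 1 w.
have mU : measurable_fun setT U.
  apply: measurable_funD => //; apply: measurable_funD; first exact: measurable_cst.
  by apply: measurable_funM => //; exact: measurable_cst.
have [a [L [c [a0 L0 c0 iY Yneg]]]] := log_drift mU
  (measurable_funPT (eps 0)) coef_log_exists coef_log_neg eps_log_moment.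
(* The coefficient at time 1 is [theta + alpha * eta 0 + eta 1], the one in the moment hypothesis;
   pairing it with the noise at time 0 gives the offset expected by [path_sum_cvg]. *)
pose Y (x : Om) : R :=
  ln (Num.max `|path_coef theta alpha (eta_path x) 1| a) +
  (ln (Num.max `|eps_path x 0| L) - ln L) + c.
have mY : measurable_fun setT Y.
  apply: measurable_funD; last exact: measurable_cst.
  apply: measurable_funD.
    apply: measurable_ln_max_abs.
    apply: measurable_funD; last exact: measurable_coord.
    apply: measurable_funD; first exact: measurable_cst.
    by apply: measurable_funM; [exact: measurable_cst|exact: measurable_coord].
  apply: measurable_funB; last exact: measurable_cst.
  by apply: measurable_ln_max_abs; exact: measurable_coord.
have mYE : measurable_fun setT (EFin \o Y) by exact/measurable_EFinP.
have iYQ : Q.-integrable setT (EFin \o Y).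
  exact: (integrable_pushforward (measurable_joint_path eps eta) mYE iY measurableT).
have YQneg : (\int[Q]_x (Y x)%:E < 0)%E.
  by rewrite (integral_pushforward (measurable_joint_path eps eta) mYE iY).
have [A [mA QA invA hA]] := bounded_birkhoff_sums (@measurable_reindex _ _ _)
  (fun A => @joint_shift_preserving (-1) A) iYQ YQneg joint_shift_ergodic.
exists A; split => // x Ax t.
have iterA n y : A (iter n (reindex (time_shift (-1))) y) = A y.
  by elim: n => // n IHn; rewrite -IHn -[in RHS]invA.
have iterE n y : iter n (reindex (time_shift (-1))) y =
    reindex (time_shift (- n%:Z)) y :> Om.
  rewrite iter_reindex; apply/funext => i.
  by rewrite /reindex iter_time_shift mulN1r.
(* For negative [t] the shifted path is an iterate of the backward shift at [x]; otherwise [x] is an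
   iterate at the shifted path. Invariance of [A] settles both cases. *)
have Atx : A (reindex (time_shift t) x).
  case: t => n; last by rewrite NegzE -iterE iterA.
  rewrite -(iterA n) iterE (_ : reindex _ _ = x)//.
  by apply/funext => -[b u]; rewrite /reindex /time_shift /= subrK.
have [K hK] := hA _ Atx.
apply: (path_sum_cvg a0 L0 c0) => n.
apply: le_trans (hK n); rewrite le_eqVlt; apply/orP; left; apply/eqP.
apply: eq_bigr => l _; rewrite iterE /Y.
have shiftE b u : reindex (time_shift (- l%:Z)) (reindex (time_shift t) x) (b, u) =
    x (b, t + u - l%:Z).
  by rewrite /reindex /time_shift /=; congr (x (_, _)); lia.
rewrite /path_coef /eps_path /eta_path !shiftE addr0.
by have -> : t + 1 - l%:Z - 1 = t - l%:Z by lia.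
Qed.

Lemma solution_series : {ae P, forall w, forall t : int,
  cvgn (solution_partial_sum theta alpha eps eta t w)}.
Proof.
have [A [mA QA hA]] := joint_series_cvg.
exists (~` (Z @^-1` A)); split.
- by apply: measurableC; exact: measurable_preimageT (measurable_joint_path eps eta) mA.
- have mpA : measurable (Z @^-1` A).
    exact: measurable_preimageT (measurable_joint_path eps eta) mA.
  have := probability_setC P mpA.
  by rewrite [P (Z @^-1` A)]QA subee.
- by apply: subsetC => w Aw t; exact: hA Aw t.
Qed.

End causal_solution.

Theorem theorem2p1 (d : measure_display) (T : measurableType d) (R : realType)
    (P : probability T R) (theta alpha : R) (eps eta : int -> {RV P >-> R})
    (eps_swn : strong_white_noise eps)
    (eta_swn : strong_white_noise eta)
    (eps_eta_indep : independent_processes eps eta)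
    (eps_log_moment : (\int[P]_w lnplus_abs (eps 0%R w) < +oo)%E)
    (coef_log_exists : expectation_exists P
       (fun w => ln_abs (theta + alpha * eta 0 w + eta 1 w)))
    (coef_log_neg :
       (\int[P]_w ln_abs (theta + alpha * eta 0%R w + eta 1%R w)%R < 0)%E) :
  exists X : int -> {RV P >-> R},
    [/\ {ae P, forall w, forall t : int,
           X t w = theta_ theta alpha eta t w * X (t - 1) w + eps t w},
        causal_wrt eps eta X,
        {ae P, forall w, forall t : int,
           cvgn (solution_partial_sum theta alpha eps eta t w) /\
           X t w = eps t w + limn (solution_partial_sum theta alpha eps eta t w)},
        strictly_stationary X
      & ergodic X].
Proof.
have cv := solution_series eps_swn eta_swn eps_eta_indep eps_log_moment
  coef_log_exists coef_log_neg.
exists (solution_rv theta alpha eps eta); split.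
- by apply: filterS cv => w cvw t; exact: path_sol_rec (cvw t) (cvw (t - 1)).
- exact: solution_causal.
- by apply: filterS cv => w cvw t; split => //; exact: path_solE (cvw t).
- exact: solution_stationary.
- exact: solution_ergodic.
Qed.
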